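(* For every natural number $n$, the following identity holds in the ring $\mathsf{Sym}$ of symmetric functions over $\mathbb{Q}$: $$\sum_{i=0}^{2n} (-1)^i (n-i)\, s_{(2n+1-i,\,1^{i})} \;=\; \sum_{i=1}^{n} p_{(2n+1-i,\,i)} \;=\; \sum_{i=1}^{n} p_{2n+1-i}\,p_{i}.$$
   Context: $\mathsf{Sym}$ denotes the algebra of symmetric functions over $\mathbb{Q}$ in countably many indeterminates $x_1,x_2,\ldots$. For $k\ge 1$, $p_k=\sum_{j\ge 1}x_j^k$ is the $k$-th power sum symmetric function, and for a partition $\mu=(\mu_1,\ldots,\mu_\ell)$, $p_\mu=p_{\mu_1}\cdots p_{\mu_\ell}$. For a partition $\lambda$, $s_\lambda$ denotes the Schur function indexed by $\lambda$ (e.g. given by the Jacobi–Trudi determinant $s_\lambda=\det(h_{\lambda_i-i+j})$, where $h_k$ is the complete homogeneous symmetric function and $h_k=0$ for $k<0$). For integers $a\ge 1$, $b\ge 0$, $(a,1^{b})$ denotes the hook partition $(a,1,1,\ldots,1)$ with $b$ parts equal to $1$ after the first part $a$. *)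

(* Defs.v *)
From HB Require Import structures.
From mathcomp Require Import all_boot all_order all_algebra finmap.
From mathcomp Require Import boolp classical_sets functions cardinality fsbigop.
From mathcomp Require Import monalg.

Set Implicit Arguments.
Unset Strict Implicit.
Unset Printing Implicit Defensive.

Import GRing.Theory.

Local Open Scope ring_scope.

(* Monomials in countably many indeterminates; the indeterminate x_(j+1) of
   the usual numbering is ucm j. *)
Definition mon := {cmonom nat}.

Definition factorizations (m : mon) : set (mon * mon) :=
  [set ab | mmul ab.1 ab.2 = m]%classic.

Lemma monP (m1 m2 : mon) : (forall i, m1 i = m2 i) -> m1 = m2.
Proof. by move=> h; apply/eqP/cmP. Qed.

Lemma finite_divisors (m : mon) :
  finite_set [set a : mon | exists b, mmul a b = m]%classic.
Proof.
pose S := finsupp m.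
pose F (f : {ffun S -> 'I_(mdeg m).+1}) : mon :=
  mkcmonom [fsfun i : S => nat_of_ord (f i) | 0%N].
have /sub_finite_set : ([set a : mon | exists b, mmul a b = m] `<=` range F)%classic.
  move=> a [b abm].
  have le_am i : (a i <= m i)%N by rewrite -abm cmM leq_addr.
  exists [ffun i : S => inord (a (val i))] => //.
  apply: monP => i; rewrite /F cmE fsfun_ffun; case: insubP => /= [u uS <-|iNS].
    rewrite ffunE inordK // ltnS (leq_trans (le_am _)) // mdegE.
    by rewrite (big_fsetD1 (val u)) //= leq_addr.
  have := le_am i; have: m i = 0%N by apply/eqP; rewrite cmE_eq0.
  by move=> ->; rewrite leqn0 => /eqP.
by apply; exact: finite_image.
Qed.

Lemma finite_factorizations (m : mon) : finite_set (factorizations m).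
Proof.
have fm := finite_divisors m.
apply: sub_finite_set (finite_setX fm fm) => -[a b] /= abm.
by split; [exists b | exists a; rewrite mulmC].
Qed.

(* Formal power series with rational coefficients in countably many
   indeterminates. *)
Record fps := FPS { fcoef : mon -> rat }.

HB.instance Definition _ := gen_eqMixin fps.
HB.instance Definition _ := gen_choiceMixin fps.

Lemma fpsP (f g : fps) : fcoef f =1 fcoef g -> f = g.
Proof. by case: f g => [f] [g] /funext /= ->. Qed.

Definition fps0 := FPS (fun=> 0).
Definition fps1 := FPS (fun m => (m == mone)%:R).
Definition fps_opp f := FPS (fun m => - fcoef f m).
Definition fps_add f g := FPS (fun m => fcoef f m + fcoef g m).
Definition fps_scale c f := FPS (fun m => c * fcoef f m).
Definition fps_mul f g := FPS (fun m =>
  \sum_(ab \in factorizations m) fcoef f ab.1 * fcoef g ab.2).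

Fact fps_addA : associative fps_add.
Proof. by move=> f g h; apply: fpsP => m /=; rewrite addrA. Qed.
Fact fps_addC : commutative fps_add.
Proof. by move=> f g; apply: fpsP => m /=; rewrite addrC. Qed.
Fact fps_add0 : left_id fps0 fps_add.
Proof. by move=> f; apply: fpsP => m /=; rewrite add0r. Qed.
Fact fps_addN : left_inverse fps0 fps_opp fps_add.
Proof. by move=> f; apply: fpsP => m /=; rewrite addNr. Qed.

HB.instance Definition _ :=
  GRing.isZmodule.Build fps fps_addA fps_addC fps_add0 fps_addN.

Lemma fps_mulE (S : seq mon) (m : mon) f g : uniq S ->
    (forall a b, mmul a b = m -> (a \in S) && (b \in S)) ->
  fcoef (fps_mul f g) m =
  \sum_(a <- S) \sum_(b <- S | mmul a b == m) fcoef f a * fcoef g b.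
Proof.
move=> uS SP /=.
transitivity (\sum_(ab <- [seq ab <- [seq (a, b) | a <- S, b <- S] |
    mmul ab.1 ab.2 == m]) fcoef f ab.1 * fcoef g ab.2); last first.
  rewrite big_filter big_mkcond big_allpairs /=.
  by apply: eq_bigr => a _; rewrite [RHS]big_mkcond.
rewrite (fsbigE [seq ab <- [seq (a, b) | a <- S, b <- S] | mmul ab.1 ab.2 == m]).
- rewrite big_seq_cond [RHS]big_seq; apply: eq_bigl => ab.
  by apply: andb_idr; rewrite mem_filter => /andP[/eqP abm _]; rewrite inE.
- by rewrite filter_uniq // allpairs_uniq // => -[? ?] [? ?].
- by move=> [a b] /=; rewrite mem_filter => /andP[/eqP].
move=> [a b] /= abm; rewrite mem_filter abm eqxx /=.
have /andP[aS bS] := SP _ _ abm.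
by case/negP; apply/allpairsP; exists (a, b).
Qed.

Lemma divisors_seq (m : mon) : exists2 S : seq mon, uniq S &
  forall a, (a \in S) <-> exists b, mmul a b = m.
Proof.
exists (fset_set [set a : mon | exists b, mmul a b = m]%classic).
  exact: fset_uniq.
by move=> a; rewrite in_fset_set ?inE //; exact: finite_divisors.
Qed.

Lemma sum_pick (S : seq mon) (P : pred mon) (x : mon) (c : rat) :
  uniq S -> (P x -> x \in S) ->
  \sum_(k <- S | P k && (x == k)) c = if P x then c else 0.
Proof.
move=> uS PS; case: ifPn => [Px|PxN]; last first.
  by rewrite big1 // => k /andP[Pk /eqP xk]; move: PxN; rewrite xk Pk.
rewrite big_mkcond (bigD1_seq x) ?PS //= Px eqxx big1 ?addr0 // => k kx.
by rewrite eq_sym (negPf kx) andbF.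
Qed.

Fact fps_mulC : commutative fps_mul.
Proof.
move=> f g; apply: fpsP => m /=.
rewrite (@reindex_fsbig _ _ _ _ _ (fun ab : mon * mon => (ab.2, ab.1))
  (factorizations m) (factorizations m)) /=.
  by apply: eq_fsbigr => ab _; rewrite mulrC.
split=> [[a b] /= <-|[a b] [c d] _ _ [-> ->] //|[a b] /= abm].
  by rewrite /factorizations /= mulmC.
by exists (b, a) => //; rewrite /factorizations /= mulmC.
Qed.

Fact fps_mulA : associative fps_mul.
Proof.
move=> f g h; apply: fpsP => m.
have [S uS SP] := divisors_seq m.
have Sclosed k a b : k \in S -> mmul a b = k -> (a \in S) && (b \in S).
  move=> /SP[l klm] abk; apply/andP; split; apply/SP.
    by exists (mmul b l); rewrite mulmA abk.
  by exists (mmul a l); rewrite mulmA (mulmC b) abk.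
have mS : m \in S by apply/SP; exists mone; rewrite mulm1.
have SPm k : k \in S -> forall a b, mmul a b = k -> (a \in S) && (b \in S).
  by move=> kS a b; apply: Sclosed.
rewrite !(fps_mulE _ _ uS (SPm _ mS)).
transitivity (\sum_(a <- S) \sum_(b <- S) \sum_(c <- S | mmul a (mmul b c) == m)
    fcoef f a * (fcoef g b * fcoef h c)).
  apply: eq_bigr => a _.
  transitivity (\sum_(k <- S | mmul a k == m) \sum_(b <- S)
     \sum_(c <- S | mmul b c == k) fcoef f a * (fcoef g b * fcoef h c)).
    rewrite big_seq_cond [RHS]big_seq_cond; apply: eq_bigr => k /andP[kS _].
    rewrite (fps_mulE _ _ uS (SPm _ kS)) mulr_sumr.
    by apply: eq_bigr => b _; rewrite mulr_sumr.
  rewrite exchange_big /=; apply: eq_bigr => b _.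
  rewrite (exchange_big_dep xpredT) //= [RHS]big_mkcond /=.
  apply: eq_bigr => c _.
  rewrite (@sum_pick _ (fun k => mmul a k == m)) // => /eqP abc.
  by have /andP[] := SPm _ mS _ _ abc.
rewrite [RHS](exchange_big_dep xpredT) //=.
under [in LHS]eq_bigr do rewrite (exchange_big_dep xpredT) //=.
rewrite [LHS]exchange_big /=; apply: eq_bigr => c _.
transitivity (\sum_(k <- S | mmul k c == m) \sum_(a <- S)
     \sum_(b <- S | mmul a b == k) fcoef f a * fcoef g b * fcoef h c); last first.
  rewrite big_seq_cond [RHS]big_seq_cond.
  apply: eq_bigr => k /andP[kS _].
  rewrite -[X in _ = X * _]/(fcoef (fps_mul f g) k).
  rewrite (fps_mulE _ _ uS (SPm _ kS)) mulr_suml.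
  by apply: eq_bigr => b _; rewrite mulr_suml.
rewrite [RHS]exchange_big /=; apply: eq_bigr => a _.
rewrite [RHS](exchange_big_dep xpredT) //= [LHS]big_mkcond /=.
apply: eq_bigr => b _; rewrite mulmA mulrA.
rewrite (@sum_pick _ (fun k => mmul k c == m)) // => /eqP abc.
by have /andP[] := SPm _ mS _ _ abc.
Qed.

Fact fps_mul1 : left_id fps1 fps_mul.
Proof.
move=> f; apply: fpsP => m /=.
rewrite (fsbigE [:: (mone, m)]) //=.
- rewrite big_cons big_nil ifT ?inE /factorizations /= ?mul1m //.
  by rewrite eqxx mul1r addr0.
- by move=> ab /=; rewrite inE => /eqP ->; rewrite /factorizations /= mul1m.
move=> [a b] /= abm; rewrite inE xpair_eqE.
have [a1|] := eqVneq a mone; last by rewrite mul0r.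
by move: abm; rewrite /factorizations /= a1 mul1m => ->; rewrite eqxx.
Qed.

Fact fps_mulDl : left_distributive fps_mul fps_add.
Proof.
move=> f g h; apply: fpsP => m /=.
rewrite -fsbig_split; last exact: finite_factorizations.
by apply: eq_fsbigr => ab _; rewrite mulrDl.
Qed.

Fact fps1_neq0 : fps1 != 0.
Proof. by apply/eqP => /(congr1 (fcoef^~ mone))/eqP; rewrite /= eqxx. Qed.

HB.instance Definition _ := GRing.Zmodule_isComNzRing.Build fps
  fps_mulA fps_mulC fps_mul1 fps_mulDl fps1_neq0.

Fact fps_scaleA a b f : fps_scale a (fps_scale b f) = fps_scale (a * b) f.
Proof. by apply: fpsP => m /=; rewrite mulrA. Qed.
Fact fps_scale1 : left_id 1 fps_scale.
Proof. by move=> f; apply: fpsP => m /=; rewrite mul1r. Qed.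
Fact fps_scaleDr : right_distributive fps_scale +%R.
Proof. by move=> a f g; apply: fpsP => m /=; rewrite mulrDr. Qed.
Fact fps_scaleDl f : {morph fps_scale^~ f : a b / a + b}.
Proof. by move=> a b; apply: fpsP => m /=; rewrite mulrDl. Qed.

HB.instance Definition _ := GRing.Zmodule_isLmodule.Build rat fps
  fps_scaleA fps_scale1 fps_scaleDr fps_scaleDl.

Fact fps_scaleAl (a : rat) (f g : fps) : a *: (f * g) = (a *: f) * g.
Proof.
apply: fpsP => m /=; rewrite mulr_fsumr.
by apply: eq_fsbigr => ab _; rewrite mulrA.
Qed.

HB.instance Definition _ := GRing.Lmodule_isLalgebra.Build rat fps fps_scaleAl.
HB.instance Definition _ := GRing.Lalgebra_isComAlgebra.Build rat fps.

Definition bounded_degree (f : fps) :=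
  exists d, forall m : mon, (d < mdeg m)%N -> fcoef f m = 0.

Definition symmetric_fps (f : fps) :=
  forall (s : nat -> nat) (m m' : mon), bijective s ->
    (forall j, m' j = m (s j)) -> fcoef f m' = fcoef f m.

Definition is_symf : {pred fps} :=
  fun f => `[< bounded_degree f /\ symmetric_fps f >].

Lemma perm_mon_subproof (s : nat -> nat) : bijective s ->
  exists2 A : mon -> mon, (forall m j, A m j = m (s j)) & bijective A.
Proof.
have gen u v : cancel u v -> cancel v u -> exists A : mon -> mon, forall m j, A m j = m (u j).
  move=> uK vK.
  exists (fun m => mkcmonom [fsfun j in [fset v i | i in finsupp m]%fset => m (u j) | 0%N]).
  move=> m j; rewrite cmE fsfun_fun; case: ifPn => // jN.
  apply/esym/eqP; rewrite cmE_eq0; apply: contra jN => ujm.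
  by apply/imfsetP; exists (u j).
move=> [t sK tK].
have [A AE] := gen _ _ sK tK; have [B BE] := gen _ _ tK sK.
by exists A => //; exists B => m; apply: monP => j; rewrite ?(AE, BE) ?(sK, tK).
Qed.

Fact is_symf_subalg : subalg_closed is_symf.
Proof.
split.
- apply/asboolP; split.
    exists 0%N => m; rewrite /= -mdeg_eq0.
    by case: (mdeg m).
  move=> s m m' [t sK tK] mm' /=; congr (_%:R); congr nat_of_bool.
  apply/eqP/eqP => m1; apply: monP => j.
    by have := mm' (t j); rewrite m1 tK !cm1.
  by rewrite mm' m1 !cm1.
- move=> c f g /asboolP[[d fd] fs] /asboolP[[e ge] gs]; apply/asboolP; split.
    exists (maxn d e) => m; rewrite gtn_max => /andP[dm em] /=.
    by rewrite fd // ge // mulr0 addr0.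
  move=> s m m' sb mm' /=.
  by rewrite (fs s m m') // (gs s m m').
move=> f g /asboolP[[d fd] fs] /asboolP[[e ge] gs]; apply/asboolP; split.
  exists (d + e)%N => m dem /=; apply: fsbig1 => -[a b] /= abm.
  have [da|ad] := ltnP d (mdeg a); first by rewrite fd ?mul0r.
  rewrite [fcoef g b]ge ?mulr0 //.
  move: dem; rewrite -abm mdegM ltnNge => demN; rewrite ltnNge.
  by apply: contra demN => be; rewrite leq_add.
move=> s m m' sb mm' /=.
have [A AE Ab] := perm_mon_subproof sb.
have -> : m' = A m by apply: monP => j; rewrite AE.
have AM a b : A (mmul a b) = mmul (A a) (A b).
  by apply: monP => j; rewrite !(AE, cmM).
rewrite (@reindex_fsbig _ _ _ _ _ (fun ab : mon * mon => (A ab.1, A ab.2))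
  (factorizations m) (factorizations (A m))) /=.
  by apply: eq_fsbigr => -[a b] _ /=; rewrite (fs s a) // (gs s b).
have Ainj := bij_inj Ab; case: Ab => B AK BK.
split=> [[a b] /= abm|[a b] [c d'] _ _ [] /= /Ainj -> /Ainj -> //|[a b] /= abm].
  by rewrite /factorizations /= -AM abm.
exists (B a, B b); last by rewrite !BK.
by apply: Ainj; rewrite AM /= !BK.
Qed.

HB.instance Definition _ :=
  GRing.isSubalgClosed.Build rat fps is_symf is_symf_subalg.

Record Sym := MkSym { symf_val :> fps; symf_valP : symf_val \in is_symf }.

HB.instance Definition _ := [isSub for symf_val].
HB.instance Definition _ := [Choice of Sym by <:].
HB.instance Definition _ := [SubChoice_isSubComNzRing of Sym by <:].
HB.instance Definition _ := [SubZmodule_isSubLmodule of Sym by <:].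
HB.instance Definition _ := [SubNzRing_SubLmodule_isSubLalgebra of Sym by <:].
HB.instance Definition _ := [SubLalgebra_isSubAlgebra of Sym by <:].

Lemma expcmnE (m : mon) k j : expcmn m k j = (k * m j)%N.
Proof.
case: k => [|k]; first exact: onecmE.
rewrite /expcmn iteropS; elim: k => [|k IHk] /=; first by rewrite mul1n.
by rewrite mulcmE IHk.
Qed.

(* The coefficientwise sum of the x_j ^ k over all j; meaningful for k > 0,
   where each coefficient is a sum with at most one nonzero term. *)
Definition power_sum_fps (k : nat) : fps :=
  FPS (fun m => \sum_(j \in [set: nat]%classic) ((m == expcmn (ucm j) k)%:R : rat)).

Lemma coef_power_sum_fps (k : nat) (m : mon) : (0 < k)%N ->
  fcoef (power_sum_fps k) m = `[< exists j, m = expcmn (ucm j) k >]%:R.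
Proof.
move=> k0 /=; case: asboolP => [[i ->]|mN]; last first.
  by apply: fsbig1 => j _; case: eqP => // mE; case: mN; exists j.
rewrite -(fsbig_widen [set i]%classic) //; first by rewrite fsbig_set1 eqxx.
move=> j /= [_ /eqP ji]; case: eqP => // /(congr1 (fun m : mon => m i)).
by rewrite !expcmnE !cmU eqxx (negPf ji) muln0 muln1 => k0'; rewrite k0' in k0.
Qed.

Fact power_sum_subproof (k : nat) : power_sum_fps k \in is_symf.
Proof.
apply/asboolP; split.
  exists k => m km /=; apply: fsbig1 => j _; case: eqP => // mE.
  suff: (mdeg m <= k)%N by rewrite leqNgt km.
  have sub : (finsupp m `<=` [fset j])%fset.
    apply/fsubsetP => i; rewrite -cmE_neq0 mE expcmnE cmU inE (eq_sym i).
    by case: (j == i); rewrite ?muln0.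
  by rewrite (mdegEw sub) big_seq_fset1 mE expcmnE cmUU muln1.
move=> s m m' sb mm' /=; have sinj := bij_inj sb.
rewrite [RHS](@reindex_fsbigT _ _ _ _ _ s) //.
apply: eq_fsbigr => j _; congr (_%:R); congr nat_of_bool.
apply/eqP/eqP => mE; apply: monP => i.
  case: sb => t sK tK; rewrite -[i]tK -mm' mE !expcmnE !cmU.
  by rewrite (inj_eq sinj).
by rewrite mm' mE !expcmnE !cmU (inj_eq sinj).
Qed.

Definition power_sum (k : nat) : Sym := MkSym (power_sum_subproof k).

Definition power_sum_part (mu : seq nat) : Sym := \prod_(k <- mu) power_sum k.

Definition complete_fps (k : nat) : fps := FPS (fun m => (mdeg m == k)%:R).

Fact complete_subproof (k : nat) : complete_fps k \in is_symf.
Proof.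
apply/asboolP; split.
  by exists k => m km /=; rewrite gtn_eqF.
move=> s m m' [t sK tK] mm' /=; congr ((_ == _)%:R).
have sub : (finsupp m' `<=` [fset t i | i in finsupp m])%fset.
  apply/fsubsetP => i; rewrite -cmE_neq0 mm' cmE_neq0 => sim.
  by apply/imfsetP; exists (s i).
rewrite (mdegEw sub) big_imfset /=; last by move=> ? ? _ _; apply: can_inj tK _ _.
by rewrite mdegE; apply: eq_bigr => i _; rewrite mm' tK.
Qed.

Definition complete (k : int) : Sym :=
  if k is Posz n then MkSym (complete_subproof n) else 0.

Definition is_part (lam : seq nat) := sorted geq lam && (0%N \notin lam).

Definition schur (lam : seq nat) : Sym :=
  \det (\matrix_(i < size lam, j < size lam)
          complete ((nth 0%N lam i)%:Z - i%:Z + j%:Z)).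

Definition hook (a b : nat) : seq nat := a :: nseq b 1%N.

Lemma hook_is_part a b : (0 < a)%N -> is_part (hook a b).
Proof.
move=> a0; rewrite /is_part /hook inE negb_or eq_sym -lt0n a0 /=.
rewrite mem_nseq andbF andbT path_min_sorted; last first.
  by apply/allP => x /nseqP[-> _].
by elim: b => //= -[|b].
Qed.

Lemma two_row_is_part a b : (0 < b <= a)%N -> is_part [:: a; b].
Proof.
move=> /andP[b0 ba]; rewrite /is_part !inE !negb_or /= ba.
by rewrite ![0%N == _]eq_sym -!lt0n b0 (leq_trans b0 ba).
Qed.

(* Main.v *)
From HB Require Import structures.
From mathcomp Require Import all_boot all_order all_algebra finmap.
From mathcomp Require Import boolp classical_sets fsbigop.
From mathcomp Require Import monalg ring zify.
Require Import Defs.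

Set Implicit Arguments.
Unset Strict Implicit.
Unset Printing Implicit Defensive.

Import GRing.Theory.
Local Open Scope ring_scope.

(** With the operator D = t d/dt, the generating series H of the complete
    functions and Q of the power sums satisfy D H = Q H (Newton), so that
    Q^2 = - (D H) (D (1/H)), where 1/H generates the (-1)^b e_b.  Hence the sum of the
    p_i p_(N-i) over 0 < i < N is that of - (-1)^b a b h_a e_b over a + b = N.
    Expanding the Jacobi-Trudi determinant along its first column gives
    h_a e_b = s_(a,1^b) + s_(a+1,1^(b-1)), and collecting terms leaves
    s_(N-i,1^i) with coefficient (-1)^i (N - 1 - 2 i).  For N = 2 n + 1 both
    sides are twice those of the theorem. *)

(** * Truncated generating series and summation by parts *)

Lemma poly_eq_modXn (R : nzRingType) (M : nat) (f g : {poly R}) :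
  (forall i, (i < M)%N -> f`_i = g`_i) -> exists r, f = g + r * 'X^M.
Proof.
move=> fg; exists (drop_poly M f - drop_poly M g).
rewrite mulrBl addrCA.
have -> : g - drop_poly M g * 'X^M = take_poly M f.
  rewrite -{1}(poly_take_drop M g) addrK.
  by apply/polyP => i; rewrite !coef_take_poly; case: ltnP => // /fg.
by rewrite addrC poly_take_drop.
Qed.

Lemma coefXderiv (R : nzRingType) (p : {poly R}) i : ('X * p^`())`_i = p`_i *+ i.
Proof. by rewrite coefXM coef_deriv; case: i. Qed.

(** Power series are replaced by polynomials cut after degree [N]. Congruence modulo ['X^(N.+1)] is
    carried by explicit cofactors [a], [b], [c], [r], so that [ring] can combine the relations. *)
Lemma newton_convolution (R : comNzRingType) (h e p : nat -> R) (N : nat) :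
    (forall k, \sum_(i < k.+1) h i * ((-1) ^+ (k - i) * e (k - i)%N) = (k == 0%N)%:R) ->
    (forall k, h k *+ k = \sum_(i < k.+1) p i * h (k - i)%N) ->
  \sum_(i < N.+1) p i * p (N - i)%N =
  - \sum_(i < N.+1) ((-1) ^+ i * e i *+ i) * (h (N - i)%N *+ (N - i)).
Proof.
move=> he ph.
pose P (u : nat -> R) := \poly_(i < N.+1) u i.
pose e' i : R := (-1) ^+ i * e i.
have coefP u i : (i < N.+1)%N -> (P u)`_i = u i by rewrite coef_poly => ->.
have coefPM u v k : (k < N.+1)%N ->
    (P u * P v)`_k = \sum_(i < k.+1) u i * v (k - i)%N.
  move=> kN; rewrite coefM; apply: eq_bigr => i _.
  by rewrite !coefP // (leq_ltn_trans _ kN) ?leq_subr // -ltnS.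
have [a aE] : exists a, P h * P e' = 1 + a * 'X^(N.+1).
  by apply: poly_eq_modXn => i iN; rewrite coefPM // coef1 he.
have [b bE] : exists b, 'X * (P h)^`() = P p * P h + b * 'X^(N.+1).
  by apply: poly_eq_modXn => i iN; rewrite coefPM // coefXderiv coefP.
(* The factor ['X] restores the degree lost by the derivative, so no precision is lost. *)
have [c cE] : exists c, 'X * (P h * P e')^`() = c * 'X^(N.+1).
  exists ('X * a^`() + a *+ N.+1).
  by rewrite aE !derivE /= mulrDl !mulrnAr mulrnAl exprS; ring.
have [r rE] : exists r,
    ('X * (P e')^`()) * ('X * (P h)^`()) = - (P p * P p) + r * 'X^(N.+1).
  (* This cofactor collects the multiples of ['X^(N.+1)] left by [bE], the Leibniz rule [DHE] and
     [aE], in that order. *)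
  exists (P p * c - P p * P p * a - P p * b * P e' + b * ('X * (P e')^`())).
  have DHE : P h * ('X * (P e')^`()) =
      c * 'X^(N.+1) - (P p * P h + b * 'X^(N.+1)) * P e'.
    by rewrite -cE -bE derivM; ring.
  rewrite bE mulrDr mulrCA [_ * P h]mulrC.
  have -> : P p * (P h * ('X * (P e')^`())) = P p * (c * 'X^(N.+1)) -
      P p * P p * (P h * P e') - P p * b * P e' * 'X^(N.+1).
    by rewrite DHE; ring.
  by rewrite aE; ring.
move/(congr1 (fun q : {poly R} => q`_N)): rE.
rewrite coefD coefMXn ltnSn addr0 coefN coefPM // => /(congr1 -%R).
rewrite opprK => <-; congr (- _); rewrite coefM; apply: eq_bigr => i _.
by rewrite !coefXderiv !coefP // ltnS leq_subr.
Qed.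

(** Summation by parts: with f(b) = b (x - b), each [T b] gets f(b + 1) - f(b) = x - 1 - 2 b up to
    sign, and only the end term at [M] remains. *)
Lemma sum_alternating_adjacent (R : comNzRingType) (T : nat -> R) (x : R) M :
  \sum_(0 <= b < M) (-1) ^+ b * (b.+1%:R * (x - b.+1%:R)) * (T b.+1 + T b) =
  \sum_(0 <= b < M) (-1) ^+ b * (x - 1 - (2 * b)%:R) * T b
    - (-1) ^+ M * (M%:R * (x - M%:R)) * T M.
Proof.
elim: M => [|M IH]; first by rewrite !big_nil; ring.
by rewrite !big_nat_recr //= IH exprS natrM -natr1; ring.
Qed.

(** * Hook Schur functions *)

Lemma complete0 : complete 0 = 1.
Proof. by apply/val_inj/fpsP => m /=; rewrite mdeg_eq0. Qed.

Lemma schur_hook0 a : schur (hook a 0) = complete a.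
Proof. by rewrite /schur det_mx11 mxE; congr complete; rewrite /=; lia. Qed.

Lemma schur_hookE a b : schur (hook a b) =
  \det (\matrix_(i < b.+1, j < b.+1)
    complete ((if i == 0 :> nat then a else 1)%N%:Z - i%:Z + j%:Z)).
Proof.
rewrite /schur /= size_nseq; congr (\det _); apply/matrixP => i j; rewrite !mxE.
by case: i => -[|i] //= iP; rewrite nth_nseq ifT.
Qed.

(** The first column of the Jacobi-Trudi matrix is h_a, h_0 = 1, then zeros, since the later indices
    are negative. Both remaining minors are again hook determinants. *)
Lemma schur_hook_rec a b : schur (hook a b.+1) =
  complete a * schur (hook 1 b) - schur (hook a.+1 b).
Proof.
rewrite !schur_hookE (expand_det_col _ ord0) !big_ord_recl /=.
rewrite big1 ?addr0; last first.
  move=> i _; rewrite mxE [X in complete X](_ : _ = Negz i) ?mul0r //=.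
  by rewrite /bump /=; lia.
rewrite /cofactor mxE [X in complete X](_ : _ = a%:Z); last by rewrite /=; lia.
rewrite mxE [X in _ + complete X * _](_ : _ = 0); last by rewrite /= /bump /=; lia.
rewrite complete0 [1 * _]mul1r addn0 expr0 mul1r expr1 mulN1r.
congr (_ * _ - _).
  congr (\det _); apply/matrixP => i j; rewrite !mxE /= /bump /=.
  by congr complete; case: ifP; lia.
congr (\det _); apply/matrixP => i j; rewrite !mxE /= /bump /=.
by congr complete; case: i => -[|i] ? /=; lia.
Qed.

(** The list is not a partition, but its determinant makes sense and its first two rows coincide. *)
Lemma schur_hook_eq0 b : schur (hook 0 b.+1) = 0.
Proof.
rewrite schur_hookE; apply: (@determinant_alternate _ _ _ ord0 (lift ord0 ord0)) => // j.
by rewrite !mxE; congr complete; rewrite /= /bump /=; lia.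
Qed.

(** Taking e_k as s_(1^k) lets the determinant expansion supply every relation used; k = 0 is
    separate because a hook has at least one part. *)
Definition elementary (k : nat) : Sym := if k is b.+1 then schur (hook 1 b) else 1.

Lemma schur_hook_sum a b : schur (hook a b) =
  \sum_(i < b.+1) (-1) ^+ i * complete (a + i)%N * elementary (b - i).
Proof.
elim: b a => [|b IH] a.
  by rewrite schur_hook0 big_ord1 addn0 mulr1 mul1r.
rewrite schur_hook_rec big_ord_recl (IH a.+1) addn0 mul1r; congr (_ + _).
rewrite -sumrN; apply: eq_bigr => i _.
by rewrite /= /bump /= exprS -addSnnS subSS; ring.
Qed.

Lemma complete_elementary k :
  \sum_(i < k.+1) complete i * ((-1) ^+ (k - i) * elementary (k - i)) = (k == 0%N)%:R.
Proof.
case: k => [|k]; first by rewrite big_ord1 complete0 !mul1r.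
(* Up to sign, the sum is [schur_hook_sum] for the degenerate hook, which vanishes. *)
transitivity ((-1) ^+ k.+1 * schur (hook 0 k.+1)); last first.
  by rewrite schur_hook_eq0 mulr0.
rewrite schur_hook_sum mulr_sumr; apply: eq_bigr => i _; rewrite add0n.
have -> : (-1) ^+ k.+1 = (-1) ^+ (k.+1 - i) * (-1) ^+ i :> Sym.
  by rewrite -exprD subnK // -ltnS.
have : (-1) ^+ i * (-1) ^+ i = 1 :> Sym by rewrite -exprMn mulrNN mulr1 expr1n.
set s := _ ^+ i => ss; rewrite -[LHS]mul1r -ss.
by ring.
Qed.

Lemma complete_elementary_hook (a b : nat) :
  complete a * elementary b.+1 = schur (hook a b.+1) + schur (hook a.+1 b).
Proof. by rewrite schur_hook_rec subrK. Qed.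

(** * Newton's identity by comparing coefficients *)

Lemma ucm_expE i j j' : expcmn (ucm j : mon) i j' = (i * (j == j'))%N.
Proof. by rewrite expcmnE cmU. Qed.

Lemma mdeg_ucm_exp i j : mdeg (expcmn (ucm j : mon) i) = i.
Proof.
rewrite (@mdegEw _ _ [fset j]%fset) ?big_seq_fset1 ?ucm_expE ?eqxx ?muln1 //.
apply/fsubsetP => k; rewrite -cmE_neq0 ucm_expE inE (eq_sym k).
by case: (j == k); rewrite ?muln0.
Qed.

Lemma divcm_ucm_expK i j (m : mon) : (i <= m j)%N ->
  mmul (expcmn (ucm j) i) (divcm m (expcmn (ucm j) i)) = m.
Proof.
move=> im; apply: monP => k; rewrite cmM divcmE ucm_expE subnKC //.
by case: eqVneq => [<-|_]; rewrite ?muln1 ?muln0.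
Qed.

(** The factorizations of [m] that contribute split off some x_j^i dividing [m]; as [i] is positive,
    distinct j give distinct ones. *)
Lemma coef_power_sum_mul i (f : fps) (m : mon) : (0 < i)%N ->
  fcoef (power_sum_fps i * f) m =
  \sum_(j <- finsupp m | (i <= m j)%N) fcoef f (divcm m (expcmn (ucm j) i)).
Proof.
move=> i0.
pose g j : mon * mon := (expcmn (ucm j) i, divcm m (expcmn (ucm j) i)).
pose r := [seq g j | j <- [seq j <- finsupp m | (i <= m j)%N]].
have rP ab : ab \in r -> factorizations m ab.
  by case/mapP => j; rewrite mem_filter => /andP[im _] ->; exact: divcm_ucm_expK.
rewrite [LHS](fsbigE r).
- rewrite big_seq_cond (eq_bigl (mem r)); last first.
    by move=> ab; apply: andb_idr => /rP; rewrite inE.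
  rewrite -big_seq big_map big_filter; apply: eq_bigr => j _.
  by rewrite coef_power_sum_fps // asboolT ?mul1r //; exists j.
- rewrite map_inj_uniq ?filter_uniq ?fset_uniq // => j k [/(congr1 (fun m : mon => m k))].
  rewrite !ucm_expE eqxx; case: eqP => // _ /esym/eqP.
  by rewrite muln0 muln1 eqn0Ngt i0.
- by move=> ab /= /rP.
move=> [a b] abm abN; rewrite coef_power_sum_fps //.
case: asboolP => [[j /= aE]|]; last by rewrite mul0r.
move: abm; rewrite /factorizations /= aE => abm.
case/negP: abN; apply/mapP; exists j.
  have im : (i <= m j)%N by rewrite -abm cmM ucm_expE eqxx muln1 leq_addr.
  by rewrite mem_filter im -cmE_neq0 -lt0n (leq_trans i0 im).
rewrite /g aE; congr (_, _).
by apply: monP => k; rewrite divcmE -abm cmM addKn.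
Qed.

(* [power_sum 0] has junk coefficients, so the index 0 is excluded. *)
Lemma newton_complete (k : nat) :
  complete k *+ k = \sum_(1 <= i < k.+1) power_sum i * complete (k - i)%N.
Proof.
apply/val_inj; rewrite raddfMn raddf_sum /=; apply: fpsP => m.
have coefMn (f : fps) l : fcoef (f *+ l) m = fcoef f m *+ l.
  by elim: l => // l IH; rewrite !mulrS /= IH.
have coef_sum (F : nat -> fps) r :
    fcoef (\sum_(i <- r) F i) m = \sum_(i <- r) fcoef (F i) m.
  by elim: r => [|i r IH]; rewrite ?big_nil // !big_cons /= IH.
rewrite coefMn coef_sum.
(* In degree [k] this double sum counts the pairs (i, j) with 1 <= i <= m_j. Each j accounts for m_j
   of them, which makes [k] in all. *)
transitivity (\sum_(1 <= i < k.+1) \sum_(j <- finsupp m | (i <= m j)%N)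
    (mdeg m == k)%:R : rat); last first.
  rewrite big_nat [RHS]big_nat; apply: eq_bigr => i /andP[i0 ik].
  rewrite coef_power_sum_mul //; apply: eq_bigr => j im /=.
  rewrite -{1}(divcm_ucm_expK im) mdegM mdeg_ucm_exp.
  by congr ((_ : bool)%:R); lia.
rewrite [LHS]/=; have [mk|_] := eqVneq (mdeg m) k; last first.
  by rewrite mul0rn big1 // => i _; rewrite big1.
rewrite (exchange_big_dep xpredT) //=.
under eq_bigr do rewrite -natr_sum.
rewrite -natr_sum -mk {1}mdegE.
congr (_ *+ _); rewrite big_seq [RHS]big_seq; apply: eq_bigr => j jm.
have jk : (m j <= mdeg m)%N by rewrite mdegE (big_fsetD1 j) //= leq_addr.
rewrite (big_cat_nat (n := (m j).+1)) //= ?ltnS //.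
rewrite [X in (_ + X)%N](_ : _ = 0%N) ?addn0.
  rewrite big_nat_cond (eq_bigl (fun i => 1 <= i < (m j).+1)%N).
    by rewrite -big_nat sum_nat_const_nat subSS subn0 muln1.
  by move=> i /=; lia.
by rewrite big_nat_cond big_pred0 // => i; lia.
Qed.

(** * Power sum convolution in terms of hooks *)

Lemma power_sum_convolution_hook (N : nat) : (0 < N)%N ->
  \sum_(1 <= i < N) power_sum i * power_sum (N - i) =
  \sum_(0 <= i < N) (-1) ^+ i * (N%:R - 1 - (2 * i)%:R) * schur (hook (N - i) i).
Proof.
case: N => // N _.
(* The value 0 at index 0 is forced by [newton] at [k = 0], as h_0 = 1. *)
pose p k : Sym := if k is 0%N then 0 else power_sum k.
pose h (k : nat) := complete k.
have newton k : h k *+ k = \sum_(i < k.+1) p i * h (k - i)%N.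
  rewrite -(big_mkord xpredT (fun i => p i * h (k - i)%N)) big_ltn // mul0r add0r.
  by rewrite /h newton_complete; apply: eq_big_nat => -[].
have <- : \sum_(i < N.+2) p i * p (N.+1 - i)%N =
    \sum_(1 <= i < N.+1) power_sum i * power_sum (N.+1 - i).
  rewrite -(big_mkord xpredT (fun i => p i * p (N.+1 - i)%N)).
  rewrite big_ltn // mul0r add0r big_nat_recr //= subnn mulr0 addr0.
  apply: eq_big_nat => -[|i] //= iN; rewrite subSS.
  by case: (N - i)%N (subn_gt0 i N) => //; lia.
rewrite (newton_convolution N.+1 complete_elementary newton).
rewrite big_ord_recl /= mulr0n mul0r add0r -sumrN.
rewrite -(big_mkord xpredT (fun i => - ((-1) ^+ bump 0 i * elementary (bump 0 i)
  *+ bump 0 i * (h (N.+1 - bump 0 i)%N *+ (N.+1 - bump 0 i))))).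
(* Choosing [x] equal to [M] kills the end term. *)
have := sum_alternating_adjacent (fun i => schur (hook (N.+1 - i) i)) N.+1%:R N.+1.
rewrite subrr !mulr0 mul0r subr0 => <-.
apply: eq_big_nat => i /andP[_ iN].
rewrite /bump /= add1n -natrB // -mulr_natr -[h _ *+ _]mulr_natr.
rewrite [(N.+1 - i)%N]subSn // -complete_elementary_hook subSS exprS /h /=.
by ring.
Qed.

Theorem theorem1 (n : nat) :
  \sum_(0 <= i < (2 * n).+1)
      ((-1) ^+ i * (n%:R - i%:R) : rat) *: schur (hook (2 * n + 1 - i) i)
    = \sum_(1 <= i < n.+1) power_sum_part [:: (2 * n + 1 - i)%N; i]
  /\
  \sum_(1 <= i < n.+1) power_sum_part [:: (2 * n + 1 - i)%N; i]
    = \sum_(1 <= i < n.+1) power_sum (2 * n + 1 - i) * power_sum i.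
Proof.
have pE : \sum_(1 <= i < n.+1) power_sum_part [:: (2 * n + 1 - i)%N; i]
    = \sum_(1 <= i < n.+1) power_sum (2 * n + 1 - i) * power_sum i.
  by apply: eq_bigr => i _; rewrite /power_sum_part !big_cons big_nil mulr1.
split=> //; rewrite pE; apply: (@scalerI _ _ 2%:R) => //.
have N0 : (0 < 2 * n + 1)%N by rewrite addn1.
transitivity (\sum_(1 <= i < 2 * n + 1) power_sum i * power_sum (2 * n + 1 - i)).
  rewrite power_sum_convolution_hook // scaler_sumr addn1.
  apply: eq_bigr => i _; rewrite scalerA.
  rewrite -[schur _ in LHS]mul1r scalerAl; congr (_ * _).
  (* The sign is a rational on one side and an element of [Sym] on the other; reduced to the parity
     of [i], it leaves two cases. *)
  rewrite mulrCA -scalerA -signr_odd -[in RHS]signr_odd.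
  have -> : (2%:R * (n%:R - i%:R) : rat) = (2 * n)%:R - (2 * i)%:R.
    by rewrite !natrM; ring.
  rewrite scalerBl !scaler_nat -natr1 addrK.
  by case: odd; rewrite ?expr0 ?expr1 ?scale1r ?scaleN1r ?mul1r ?mulN1r.
(* As 2 n + 1 is odd, there is no middle term, and i -> 2 n + 1 - i exchanges the two halves. *)
rewrite (big_cat_nat (n := n.+1)) //=; last by lia.
rewrite scaler_nat mulr2n; congr (_ + _).
  by apply: eq_bigr => i _; rewrite mulrC.
rewrite big_nat_rev /= -{1}[n.+1]add1n big_addn.
rewrite [X in \sum_(_ <= _ < X) _](_ : _ = n.+1); last by lia.
apply: eq_big_nat => i /andP[i0 iN].
by congr (power_sum _ * power_sum _); lia.
Qed.
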